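(* Let $\mathcal{A}$, $\mathcal{B}$, $\mathcal{C}$ be extriangulated categories satisfying the (WIC) condition. Then each recollement $(\mathcal{A},\mathcal{B},\mathcal{C})$ of extriangulated categories in the sense of Wang--Wei--Zhang is an $\mathfrak{s}$-recollement.
   Context: Extriangulated categories (Nakaoka--Palu). An extriangulated category is a triple $(\mathcal{C},\mathbb{E},\mathfrak{s})$ where $\mathcal{C}$ is an additive category, $\mathbb{E}:\mathcal{C}^{\mathrm{op}}\times\mathcal{C}\to\mathrm{Ab}$ is an additive bifunctor (write $a_*\delta=\mathbb{E}(C,a)(\delta)$ and $c^*\delta=\mathbb{E}(c,A)(\delta)$), and $\mathfrak{s}$ assigns to each $\delta\in\mathbb{E}(C,A)$ an equivalence class $\mathfrak{s}(\delta)=[A\xrightarrow{x}B\xrightarrow{y}C]$ (two such sequences are equivalent if there is an isomorphism of the middle terms compatible with the identities of $A$ and $C$), such that: (i) if $\mathfrak{s}(\delta)=[A\xrightarrow{x}B\xrightarrow{y}C]$, $\mathfrak{s}(\delta')=[A'\xrightarrow{x'}B'\xrightarrow{y'}C']$ and $a:A\to A'$, $c:C\to C'$ satisfy $a_*\delta=c^*\delta'$, there is $b:B\to B'$ with $bx=x'a$, $y'b=cy$; (ii) $\mathfrak{s}(0)$ is the split sequence and $\mathfrak{s}(\delta\oplus\delta')=\mathfrak{s}(\delta)\oplus\mathfrak{s}(\delta')$; (ET3) for $\delta,\delta'$ realized as in (i) and $a,b$ with $bx=x'a$ there is $c$ with $cy=y'b$ and $a_*\delta=c^*\delta'$; (ET3)$^{\mathrm{op}}$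 its dual; (ET4) if $\delta\in\mathbb{E}(D,A)$, $\delta'\in\mathbb{E}(F,B)$ are realized by $A\xrightarrow{f}B\xrightarrow{f'}D$ and $B\xrightarrow{g}C\xrightarrow{g'}F$, there are $E$, $\delta''\in\mathbb{E}(E,A)$ realized by $A\xrightarrow{gf}C\xrightarrow{h'}E$, and $d:D\to E$, $e:E\to F$ with $h'g=df'$, $eh'=g'$, $D\xrightarrow{d}E\xrightarrow{e}F$ realizing $f'_*\delta'$, $d^*\delta''=\delta$, $f_*\delta''=e^*\delta'$; (ET4)$^{\mathrm{op}}$ its dual. If $\mathfrak{s}(\delta)=[A\xrightarrow{x}B\xrightarrow{y}C]$, the sequence is a conflation, $x$ is an inflation, $y$ is a deflation, $C=\mathrm{Cone}(x)$, $A=\mathrm{CoCone}(y)$, and $A\to B\to C\overset{\delta}{\dashrightarrow}$ is an $\mathbb{E}$-triangle. (WIC) condition: for composable $f:X\to Y$, $g:Y\to Z$: (1) if $gf$ is an inflation then $f$ is an inflation; (2) if $gf$ is a deflation then $g$ is a deflation. Exact functor ($\mathfrak{s}$-exact functor). An additive functor $F:\mathcal{A}\to\mathcal{B}$ between extriangulated categories is exact if there is a natural transformation $\eta:\mathbb{E}_{\mathcal{A}}(-,-)\Rightarrow\mathbb{E}_{\mathcal{B}}(F(-),F(-))$ with $\mathfrak{s}_{\mathcal{B}}(\eta_{(C,A)}(\delta))=[FA\xrightarrow{Fx}FB\xrightarrow{Fy}FC]$ whenever $\mathfrak{s}_{\mathcal{A}}(\delta)=[A\xrightarrow{x}B\xrightarrow{y}C]$.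 A sequence $A\xrightarrow{f}B\xrightarrow{g}C$ is right $\mathfrak{s}$-exact if there are an $\mathbb{E}$-triangle $K\xrightarrow{h_2}B\xrightarrow{g}C\dashrightarrow$ and a deflation $h_1:A\to K$ with $f=h_2h_1$; it is left $\mathfrak{s}$-exact if there are an $\mathbb{E}$-triangle $A\xrightarrow{f}B\xrightarrow{h_1}K\dashrightarrow$ and an inflation $h_2:K\to C$ with $g=h_2h_1$. $\mathfrak{s}$-recollement $(\mathcal{A},\mathcal{B},\mathcal{C})$: additive functors $i_*:\mathcal{A}\to\mathcal{B}$, $i^*,i^!:\mathcal{B}\to\mathcal{A}$, $j^*:\mathcal{B}\to\mathcal{C}$, $j_!,j_*:\mathcal{C}\to\mathcal{B}$ such that: (SR1) $(i^*,i_*,i^!)$ and $(j_!,j^*,j_* )$ are adjoint triples, and $i_*$ and $j^*$ are exact; (SR2) $j^*i_*=0$; (SR3) $i_*,j_!,j_*$ are fully faithful; (SR4) for each $X\in\mathcal{B}$ there are a left $\mathfrak{s}$-exact sequence $i_*i^!X\xrightarrow{\theta_X}X\xrightarrow{\vartheta_X}j_*j^*X$ and a right $\mathfrak{s}$-exact sequence $j_!j^*X\xrightarrow{\upsilon_X}X\xrightarrow{\nu_X}i_*i^*X$, with $\mathrm{Cone}(\theta_X)\in\mathrm{Ker}\,i^!$ and $\mathrm{CoCone}(\nu_X)\in\mathrm{Ker}\,i^*$, all maps being the adjunction (unit/counit) morphisms; (SR5) $\mathrm{Ker}\,i^!\cap\mathrm{Ker}\,j^*=0$ or $\mathrm{Ker}\,i^*\cap\mathrm{Ker}\,j^*=0$.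 Here $\mathrm{Ker}\,F$ is the full subcategory of objects annihilated by $F$. Wang--Wei--Zhang recollements. A morphism $f$ is compatible if ''$f$ is both an inflation and a deflation'' implies that $f$ is an isomorphism. A WWZ-right exact sequence is a right $\mathfrak{s}$-exact sequence for which the deflation $h_1$ can be chosen compatible; a WWZ-left exact sequence is a left $\mathfrak{s}$-exact sequence for which the inflation $h_2$ can be chosen compatible. A $4$-term sequence $A\xrightarrow{f}B\xrightarrow{g}C\xrightarrow{h}D$ is a right exact (resp. left exact) $\mathbb{E}$-triangle sequence if there are $\mathbb{E}$-triangles $A\xrightarrow{f}B\xrightarrow{g_1}K\dashrightarrow$ and $K\xrightarrow{g_2}C\xrightarrow{h}D\dashrightarrow$ with $g=g_2g_1$ and $g_1$ (resp. $g_2$) compatible. A WWZ-right exact functor $F$ is an additive functor which preserves compatible morphisms, sends WWZ-right exact sequences to WWZ-right exact sequences (so that for each $\mathbb{E}$-triangle $A\xrightarrow{f}B\xrightarrow{g}C\overset{\delta}{\dashrightarrow}$ there is an $\mathbb{E}$-triangle $A'\xrightarrow{x}FB\xrightarrow{Fg}FC\dashrightarrow$ with $Ff=xy$ for a compatible deflation $y:FA\to A'$), and is equipped with a natural transformation $\eta_{(C,A)}:\mathbb{E}_{\mathcal{A}}(C,A)\to\mathbb{E}_{\mathcal{B}}(FC,A')$ with $\mathfrak{s}_{\mathcal{B}}(\eta_{(C,A)}(\delta))=[A'\xrightarrow{x}FB\xrightarrow{Fg}FC]$; WWZ-left exact functors are defined dually. A WWZ-exact functor is an exact functor (that is, an additive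 functor $F:\mathcal{A}\to\mathcal{B}$ between extriangulated categories for which there is a natural transformation $\eta:\mathbb{E}_{\mathcal{A}}(-,-)\Rightarrow\mathbb{E}_{\mathcal{B}}(F(-),F(-))$ with $\mathfrak{s}_{\mathcal{B}}(\eta_{(C,A)}(\delta))=[FA\xrightarrow{Fx}FB\xrightarrow{Fy}FC]$ whenever $\mathfrak{s}_{\mathcal{A}}(\delta)=[A\xrightarrow{x}B\xrightarrow{y}C]$) that preserves compatible morphisms. A recollement of extriangulated categories in the sense of Wang--Wei--Zhang is a diagram of functors $i_*:\mathcal{A}\to\mathcal{B}$, $i^*,i^!:\mathcal{B}\to\mathcal{A}$, $j^*:\mathcal{B}\to\mathcal{C}$, $j_!,j_*:\mathcal{C}\to\mathcal{B}$ with $i_*,j^*$ WWZ-exact, $i^*,j_!$ WWZ-right exact and $i^!,j_*$ WWZ-left exact, such that: $(i^*,i_*,i^!)$ and $(j_!,j^*,j_* )$ are adjoint triples; $\mathrm{Im}\,i_*=\mathrm{Ker}\,j^*$; $i_*,j_!,j_*$ are fully faithful; for each $X\in\mathcal{B}$ there is a left exact $\mathbb{E}_{\mathcal{B}}$-triangle sequence $i_*i^!X\xrightarrow{\theta_X}X\xrightarrow{\vartheta_X}j_*j^*X\to i_*A$ with $A\in\mathcal{A}$, and a right exact $\mathbb{E}_{\mathcal{B}}$-triangle sequence $i_*A'\to j_!j^*X\xrightarrow{\upsilon_X}X\xrightarrow{\nu_X}i_*i^*X$ with $A'\in\mathcal{A}$, where $\theta_X,\vartheta_X,\upsilon_X,\nu_X$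 are the adjunction morphisms. *)

(* Defs.v *)
From mathcomp Require Import all_boot all_algebra.

Set Implicit Arguments.
Unset Strict Implicit.
Unset Printing Implicit Defensive.

Import GRing.Theory.

Local Open Scope ring_scope.

Reserved Notation "g ∘ f" (at level 40, left associativity).

Record preadditive := Preadditive {
  obj :> Type;
  hom : obj -> obj -> zmodType;
  idm : forall X : obj, hom X X;
  comp : forall X Y Z : obj, hom Y Z -> hom X Y -> hom X Z;
  compA : forall (X Y Z T : obj) (h : hom Z T) (g : hom Y Z) (f : hom X Y),
    comp h (comp g f) = comp (comp h g) f;
  comp1m : forall (X Y : obj) (f : hom X Y), comp (idm Y) f = f;
  compm1 : forall (X Y : obj) (f : hom X Y), comp f (idm X) = f;
  compDl : forall (X Y Z : obj) (g g' : hom Y Z) (f : hom X Y),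
    comp (g + g') f = comp g f + comp g' f;
  compDr : forall (X Y Z : obj) (g : hom Y Z) (f f' : hom X Y),
    comp g (f + f') = comp g f + comp g f'
}.

Arguments hom {p} X Y.
Arguments idm {p} X.
Arguments comp {p X Y Z} g f.

Notation "g ∘ f" := (comp g f) : ring_scope.

Section Preadditive.
Variable C : preadditive.

Definition is_iso (X Y : C) (f : hom X Y) : Prop :=
  exists g : hom Y X, g ∘ f = idm X /\ f ∘ g = idm Y.

Definition isomorphic (X Y : C) : Prop := exists f : hom X Y, is_iso f.

(* [0] is always a morphism, so being initial and terminal amounts to [0]
   being the only morphism out of, resp. into, X. *)
Definition is_zero (X : C) : Prop :=
  (forall (Y : C) (f : hom X Y), f = 0) /\
  (forall (Y : C) (f : hom Y X), f = 0).

End Preadditive.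

Record additiveCategory := AdditiveCategory {
  preadd :> preadditive;
  zero_obj : preadd;
  zero_objP : is_zero zero_obj;
  biprod : preadd -> preadd -> preadd;
  inl_m : forall X Y : preadd, hom X (biprod X Y);
  inr_m : forall X Y : preadd, hom Y (biprod X Y);
  prl_m : forall X Y : preadd, hom (biprod X Y) X;
  prr_m : forall X Y : preadd, hom (biprod X Y) Y;
  prl_inl : forall X Y : preadd, prl_m X Y ∘ inl_m X Y = idm X;
  prr_inr : forall X Y : preadd, prr_m X Y ∘ inr_m X Y = idm Y;
  prl_inr : forall X Y : preadd, prl_m X Y ∘ inr_m X Y = 0;
  prr_inl : forall X Y : preadd, prr_m X Y ∘ inl_m X Y = 0;
  biprod_id : forall X Y : preadd,
    inl_m X Y ∘ prl_m X Y + inr_m X Y ∘ prr_m X Y = idm (biprod X Y)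
}.

Arguments biprod {a} X Y.
Arguments inl_m {a} X Y.
Arguments inr_m {a} X Y.
Arguments prl_m {a} X Y.
Arguments prr_m {a} X Y.

Definition biprod_map (C : additiveCategory) (X Y X' Y' : C)
    (f : hom X Y) (f' : hom X' Y') : hom (biprod X X') (biprod Y Y') :=
  inl_m Y Y' ∘ f ∘ prl_m X X' + inr_m Y Y' ∘ f' ∘ prr_m X X'.

(* [ext C A] is E(C,A), contravariant in C and covariant in A;
   [push a] is a_* = E(C,a) and [pull c] is c^* = E(c,A). *)
Record biadditive (C : additiveCategory) := Biadditive {
  ext : C -> C -> zmodType;
  push : forall Z X X' : C, hom X X' -> {additive ext Z X -> ext Z X'};
  pull : forall Z Z' X : C, hom Z' Z -> {additive ext Z X -> ext Z' X};
  push1 : forall (Z X : C) (d : ext Z X), push Z (idm X) d = d;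
  push_comp : forall (Z X X' X'' : C) (a' : hom X' X'') (a : hom X X')
    (d : ext Z X), push Z (a' ∘ a) d = push Z a' (push Z a d);
  pull1 : forall (Z X : C) (d : ext Z X), pull X (idm Z) d = d;
  pull_comp : forall (Z Z' Z'' X : C) (c : hom Z' Z) (c' : hom Z'' Z')
    (d : ext Z X), pull X (c ∘ c') d = pull X c' (pull X c d);
  push_pull : forall (Z Z' X X' : C) (a : hom X X') (c : hom Z' Z)
    (d : ext Z X), push Z' a (pull X c d) = pull X' c (push Z a d);
  pushDm : forall (Z X X' : C) (a a' : hom X X') (d : ext Z X),
    push Z (a + a') d = push Z a d + push Z a' d;
  pullDm : forall (Z Z' X : C) (c c' : hom Z' Z) (d : ext Z X),
    pull X (c + c') d = pull X c d + pull X c' d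
}.

Arguments ext {C} b Z X.
Arguments push {C b Z X X'} a.
Arguments pull {C b Z Z' X} c.

Definition ext_sum (C : additiveCategory) (E : biadditive C) (Z Z' X X' : C)
    (d : ext E Z X) (d' : ext E Z' X') : ext E (biprod Z Z') (biprod X X') :=
  push (inl_m X X') (pull (prl_m Z Z') d) +
  push (inr_m X X') (pull (prr_m Z Z') d').

Definition seq_equiv (C : preadditive) (A B B' D : C)
    (x : hom A B) (y : hom B D) (x' : hom A B') (y' : hom B' D) : Prop :=
  exists b : hom B B', [/\ is_iso b, b ∘ x = x' & y' ∘ b = y].

(* [realizes d x y] means s(d) = [A -x-> B -y-> D]: the predicate
   [realizes d] is the equivalence class s(d) itself ([real_class]). *)
Record extriangulated := Extriangulated {
  addcat :> additiveCategory;
  bifun : biadditive addcat;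
  realizes : forall A B D : addcat,
    ext bifun D A -> hom A B -> hom B D -> Prop;
  real_ex : forall (A D : addcat) (d : ext bifun D A),
    exists (B : addcat) (x : hom A B) (y : hom B D), realizes d x y;
  real_class : forall (A B B' D : addcat) (d : ext bifun D A)
    (x : hom A B) (y : hom B D) (x' : hom A B') (y' : hom B' D),
    realizes d x y -> (realizes d x' y' <-> seq_equiv x y x' y');
  real_mor : forall (A B D A' B' D' : addcat)
    (d : ext bifun D A) (d' : ext bifun D' A')
    (x : hom A B) (y : hom B D) (x' : hom A' B') (y' : hom B' D')
    (a : hom A A') (c : hom D D'),
    realizes d x y -> realizes d' x' y' -> push a d = pull c d' ->
    exists b : hom B B', b ∘ x = x' ∘ a /\ y' ∘ b = c ∘ y;
  real_split : forall A D : addcat,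
    realizes (0 : ext bifun D A) (inl_m A D) (prr_m A D);
  real_sum : forall (A B D A' B' D' : addcat)
    (d : ext bifun D A) (d' : ext bifun D' A')
    (x : hom A B) (y : hom B D) (x' : hom A' B') (y' : hom B' D'),
    realizes d x y -> realizes d' x' y' ->
    realizes (ext_sum d d') (biprod_map x x') (biprod_map y y');
  ET3 : forall (A B D A' B' D' : addcat)
    (d : ext bifun D A) (d' : ext bifun D' A')
    (x : hom A B) (y : hom B D) (x' : hom A' B') (y' : hom B' D')
    (a : hom A A') (b : hom B B'),
    realizes d x y -> realizes d' x' y' -> b ∘ x = x' ∘ a ->
    exists c : hom D D', c ∘ y = y' ∘ b /\ push a d = pull c d';
  ET3op : forall (A B D A' B' D' : addcat)
    (d : ext bifun D A) (d' : ext bifun D' A')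
    (x : hom A B) (y : hom B D) (x' : hom A' B') (y' : hom B' D')
    (b : hom B B') (c : hom D D'),
    realizes d x y -> realizes d' x' y' -> c ∘ y = y' ∘ b ->
    exists a : hom A A', b ∘ x = x' ∘ a /\ push a d = pull c d';
  ET4 : forall (A B C D F : addcat)
    (dl : ext bifun D A) (dl' : ext bifun F B)
    (f : hom A B) (f' : hom B D) (g : hom B C) (g' : hom C F),
    realizes dl f f' -> realizes dl' g g' ->
    exists (E : addcat) (dl'' : ext bifun E A)
      (h' : hom C E) (d : hom D E) (e : hom E F),
      [/\ realizes dl'' (g ∘ f) h',
          h' ∘ g = d ∘ f' /\ e ∘ h' = g',
          realizes (push f' dl') d e,
          pull d dl'' = dl
        & push f dl'' = pull e dl'];
  ET4op : forall (A B C D F : addcat)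
    (dl : ext bifun A D) (dl' : ext bifun B F)
    (f' : hom D B) (f : hom B A) (g' : hom F C) (g : hom C B),
    realizes dl f' f -> realizes dl' g' g ->
    exists (E : addcat) (dl'' : ext bifun A E)
      (h' : hom E C) (d : hom E D) (e : hom F E),
      [/\ realizes dl'' h' (f ∘ g),
          g ∘ h' = f' ∘ d /\ h' ∘ e = g',
          realizes (pull f' dl') e d,
          push d dl'' = dl
        & pull f dl'' = push e dl']
}.

Arguments realizes {e A B D} d x y.

Notation Ext C := (ext (bifun C)).

Section Extriangulated.
Variable C : extriangulated.

Definition conflation (A B D : C) (x : hom A B) (y : hom B D) : Prop :=
  exists d : Ext C D A, realizes d x y.

Definition inflation (A B : C) (x : hom A B) : Prop :=
  exists (D : C) (y : hom B D), conflation x y.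

Definition deflation (B D : C) (y : hom B D) : Prop :=
  exists (A : C) (x : hom A B), conflation x y.

(* Cones and cocones are only defined up to isomorphism. *)
Definition is_cone (A B : C) (x : hom A B) (D : C) : Prop :=
  exists y : hom B D, conflation x y.

Definition is_cocone (B D : C) (y : hom B D) (A : C) : Prop :=
  exists x : hom A B, conflation x y.

Definition WIC : Prop :=
  (forall (X Y Z : C) (f : hom X Y) (g : hom Y Z),
     inflation (g ∘ f) -> inflation f) /\
  (forall (X Y Z : C) (f : hom X Y) (g : hom Y Z),
     deflation (g ∘ f) -> deflation g).

Definition compatible (X Y : C) (f : hom X Y) : Prop :=
  inflation f /\ deflation f -> is_iso f.

Definition right_s_exact (A B D : C) (f : hom A B) (g : hom B D) : Prop :=
  exists (K : C) (h2 : hom K B) (h1 : hom A K),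
    [/\ conflation h2 g, deflation h1 & f = h2 ∘ h1].

Definition left_s_exact (A B D : C) (f : hom A B) (g : hom B D) : Prop :=
  exists (K : C) (h1 : hom B K) (h2 : hom K D),
    [/\ conflation f h1, inflation h2 & g = h2 ∘ h1].

Definition WWZ_right_exact_seq (A B D : C) (f : hom A B) (g : hom B D) : Prop :=
  exists (K : C) (h2 : hom K B) (h1 : hom A K),
    [/\ conflation h2 g, deflation h1, compatible h1 & f = h2 ∘ h1].

Definition WWZ_left_exact_seq (A B D : C) (f : hom A B) (g : hom B D) : Prop :=
  exists (K : C) (h1 : hom B K) (h2 : hom K D),
    [/\ conflation f h1, inflation h2, compatible h2 & g = h2 ∘ h1].

Definition right_exact_triangle_seq (X Y Z T : C)
    (f : hom X Y) (g : hom Y Z) (h : hom Z T) : Prop :=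
  exists (K : C) (g1 : hom Y K) (g2 : hom K Z),
    [/\ conflation f g1, conflation g2 h, g = g2 ∘ g1 & compatible g1].

Definition left_exact_triangle_seq (X Y Z T : C)
    (f : hom X Y) (g : hom Y Z) (h : hom Z T) : Prop :=
  exists (K : C) (g1 : hom Y K) (g2 : hom K Z),
    [/\ conflation f g1, conflation g2 h, g = g2 ∘ g1 & compatible g2].

End Extriangulated.

Record additiveFunctor (A B : preadditive) := AdditiveFunctor {
  fobj :> A -> B;
  fmap : forall X Y : A, {additive hom X Y -> hom (fobj X) (fobj Y)};
  fmap1 : forall X : A, fmap X X (idm X) = idm (fobj X);
  fmap_comp : forall (X Y Z : A) (g : hom Y Z) (f : hom X Y),
    fmap X Z (g ∘ f) = fmap Y Z g ∘ fmap X Y f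
}.

Arguments fmap {A B} F {X Y} : rename.

Definition fully_faithful (A B : preadditive) (F : additiveFunctor A B) : Prop :=
  forall X Y : A, bijective (@fmap A B F X Y).

(* F is left adjoint to G. *)
Record adjunction (A B : preadditive)
    (F : additiveFunctor A B) (G : additiveFunctor B A) := Adjunction {
  adj_unit : forall X : A, hom X (G (F X));
  adj_counit : forall Y : B, hom (F (G Y)) Y;
  unit_nat : forall (X X' : A) (f : hom X X'),
    adj_unit X' ∘ f = fmap G (fmap F f) ∘ adj_unit X;
  counit_nat : forall (Y Y' : B) (g : hom Y Y'),
    adj_counit Y' ∘ fmap F (fmap G g) = g ∘ adj_counit Y;
  counit_unit : forall X : A,
    adj_counit (F X) ∘ fmap F (adj_unit X) = idm (F X);
  unit_counit : forall Y : B,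
    fmap G (adj_counit Y) ∘ adj_unit (G Y) = idm (G Y)
}.

Arguments adj_unit {A B F G} a X.
Arguments adj_counit {A B F G} a Y.

Section ExactFunctors.
Variables (A B : extriangulated) (F : additiveFunctor A B).

Definition exact_functor : Prop :=
  exists eta : forall Z X : A, {additive Ext A Z X -> Ext B (F Z) (F X)},
    [/\ forall (Z X X' : A) (a : hom X X') (d : Ext A Z X),
          eta Z X' (push a d) = push (fmap F a) (eta Z X d),
        forall (Z Z' X : A) (c : hom Z' Z) (d : Ext A Z X),
          eta Z' X (pull c d) = pull (fmap F c) (eta Z X d)
      & forall (X Y Z : A) (d : Ext A Z X) (x : hom X Y) (y : hom Y Z),
          realizes d x y -> realizes (eta Z X d) (fmap F x) (fmap F y)].

Definition preserves_compatible : Prop :=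
  forall (X Y : A) (f : hom X Y), compatible f -> compatible (fmap F f).

Definition WWZ_exact_functor : Prop := exact_functor /\ preserves_compatible.

(* In "E(C,A) -> E(FC,A')" the object A' depends on the extension d and not
   only on (C,A), e.g. A' is the image of F(f) when F is a right exact functor
   of abelian categories; hence the dependent type of [eta], for which
   additivity would be meaningless.  Naturality is that of the squares attached
   to the morphisms (a, c) : d -> d' of extensions, i.e. a_* d = c^* d', where
   a' : A'_d -> A'_d' is a morphism induced by a. *)
Definition WWZ_right_exact_functor : Prop :=
  [/\ preserves_compatible,
      forall (X Y Z : A) (f : hom X Y) (g : hom Y Z),
        WWZ_right_exact_seq f g -> WWZ_right_exact_seq (fmap F f) (fmap F g)
    & exists (A' : forall Z X : A, Ext A Z X -> B)
        (y : forall (Z X : A) (d : Ext A Z X), hom (F X) (A' Z X d))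
        (eta : forall (Z X : A) (d : Ext A Z X), Ext B (F Z) (A' Z X d)),
        [/\ forall (Z X : A) (d : Ext A Z X),
              deflation (y Z X d) /\ compatible (y Z X d),
            forall (X Y Z : A) (d : Ext A Z X) (f : hom X Y) (g : hom Y Z),
              realizes d f g ->
              exists x : hom (A' Z X d) (F Y),
                fmap F f = x ∘ y Z X d /\ realizes (eta Z X d) x (fmap F g)
          & forall (Z X Z1 X1 : A) (d : Ext A Z X) (d1 : Ext A Z1 X1)
              (a : hom X X1) (c : hom Z Z1),
              push a d = pull c d1 ->
              exists a' : hom (A' Z X d) (A' Z1 X1 d1),
                a' ∘ y Z X d = y Z1 X1 d1 ∘ fmap F a /\
                push a' (eta Z X d) = pull (fmap F c) (eta Z1 X1 d1)]].

Definition WWZ_left_exact_functor : Prop :=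
  [/\ preserves_compatible,
      forall (X Y Z : A) (f : hom X Y) (g : hom Y Z),
        WWZ_left_exact_seq f g -> WWZ_left_exact_seq (fmap F f) (fmap F g)
    & exists (C' : forall Z X : A, Ext A Z X -> B)
        (y : forall (Z X : A) (d : Ext A Z X), hom (C' Z X d) (F Z))
        (eta : forall (Z X : A) (d : Ext A Z X), Ext B (C' Z X d) (F X)),
        [/\ forall (Z X : A) (d : Ext A Z X),
              inflation (y Z X d) /\ compatible (y Z X d),
            forall (X Y Z : A) (d : Ext A Z X) (f : hom X Y) (g : hom Y Z),
              realizes d f g ->
              exists x : hom (F Y) (C' Z X d),
                fmap F g = y Z X d ∘ x /\ realizes (eta Z X d) (fmap F f) x
          & forall (Z X Z1 X1 : A) (d : Ext A Z X) (d1 : Ext A Z1 X1)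
              (a : hom X X1) (c : hom Z Z1),
              push a d = pull c d1 ->
              exists c' : hom (C' Z X d) (C' Z1 X1 d1),
                y Z1 X1 d1 ∘ c' = fmap F c ∘ y Z X d /\
                push (fmap F a) (eta Z X d) = pull c' (eta Z1 X1 d1)]].

End ExactFunctors.

(* The data common to both notions of recollement: six additive functors and
   the adjoint triples (i^*, i_*, i^!) and (j_!, j^*, j_* ). *)
Record recollementDiagram (A B C : preadditive) := RecollementDiagram {
  i_lower : additiveFunctor A B;  (* i_* *)
  i_upper : additiveFunctor B A;  (* i^* *)
  i_shriek : additiveFunctor B A; (* i^! *)
  j_upper : additiveFunctor B C;  (* j^* *)
  j_shriek : additiveFunctor C B; (* j_! *)
  j_lower : additiveFunctor C B;  (* j_* *)
  adj_iu_il : adjunction i_upper i_lower;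
  adj_il_is : adjunction i_lower i_shriek;
  adj_js_ju : adjunction j_shriek j_upper;
  adj_ju_jl : adjunction j_upper j_lower
}.

Section Recollements.
Variables A B C : extriangulated.
Variable R : recollementDiagram A B C.

Let iL := i_lower R.
Let iU := i_upper R.
Let iS := i_shriek R.
Let jU := j_upper R.
Let jS := j_shriek R.
Let jL := j_lower R.

Definition theta (X : B) : hom (iL (iS X)) X := adj_counit (adj_il_is R) X.
Definition vartheta (X : B) : hom X (jL (jU X)) := adj_unit (adj_ju_jl R) X.
Definition upsilon (X : B) : hom (jS (jU X)) X := adj_counit (adj_js_ju R) X.
Definition nu (X : B) : hom X (iL (iU X)) := adj_unit (adj_iu_il R) X.

Definition s_recollement : Prop :=
  [/\ exact_functor iL /\ exact_functor jU,
      forall X : A, is_zero (jU (iL X)),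
      [/\ fully_faithful iL, fully_faithful jS & fully_faithful jL],
      forall X : B,
        [/\ left_s_exact (theta X) (vartheta X),
            right_s_exact (upsilon X) (nu X),
            forall K : B, is_cone (theta X) K -> is_zero (iS K)
          & forall K : B, is_cocone (nu X) K -> is_zero (iU K)]
    & (forall X : B, is_zero (iS X) -> is_zero (jU X) -> is_zero X) \/
      (forall X : B, is_zero (iU X) -> is_zero (jU X) -> is_zero X)].

(* Im i_* is the essential image, Ker j^* being closed under isomorphism. *)
Definition WWZ_recollement : Prop :=
  [/\ WWZ_exact_functor iL /\ WWZ_exact_functor jU,
      (WWZ_right_exact_functor iU /\ WWZ_right_exact_functor jS) /\
      (WWZ_left_exact_functor iS /\ WWZ_left_exact_functor jL),
      forall X : B, (exists Y : A, isomorphic (iL Y) X) <-> is_zero (jU X),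
      [/\ fully_faithful iL, fully_faithful jS & fully_faithful jL]
    & forall X : B,
        (exists (Y : A) (h : hom (jL (jU X)) (iL Y)),
           left_exact_triangle_seq (theta X) (vartheta X) h) /\
        (exists (Y : A) (h : hom (iL Y) (jS (jU X))),
           right_exact_triangle_seq h (upsilon X) (nu X))].

End Recollements.

(* Main.v *)
From mathcomp Require Import all_boot all_algebra.
Require Import Defs.

Set Implicit Arguments.
Unset Strict Implicit.
Unset Printing Implicit Defensive.

Import GRing.Theory.

Local Open Scope ring_scope.

(** The point that is not part of the definition of a Wang--Wei--Zhang
    recollement is that the cocone of [nu X] is killed by i^* and the cone of
    [theta X] is killed by i^!; the two are dual.

    Consider the conflations i_*Y -> j_!j^*X -g1-> K and K -> X -> i_*i^*X that
    make up the right exact sequence at X, with g1 compatible.  By adjunction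
    j^*i_* = 0 gives i^*j_! = 0, so i^*g1 goes from a zero object to i^*K.  It is
    an inflation, as is every morphism out of a zero object; it is a deflation
    because the right exact functor i^* preserves deflations; and it is
    compatible because i^* preserves compatible morphisms.  Hence it is an
    isomorphism, and i^*K = 0 ([compatible_from_zero]).

    This settles one cocone of [nu X].  To pass to an arbitrary one without
    the uniqueness of cocones, [cocone_functor_zero] uses that i^*(nu X) is a
    split monomorphism by a triangle identity.

    Finally Ker i^! and Ker j^* meet in 0: if j^*X = 0 then X is isomorphic to
    some i_*Y, and Hom(i_*Y, X) = Hom(Y, i^!X) vanishes as soon as i^!X = 0. *)

(** * Zero morphisms and zero objects *)

Section ZeroMorphisms.
Variable C : preadditive.

Lemma comp0m (X Y Z : C) (f : hom X Y) : (0 : hom Y Z) ∘ f = 0.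
Proof. by apply: (addrI (0 ∘ f)); rewrite -compDl !addr0. Qed.

Lemma compm0 (X Y Z : C) (g : hom Y Z) : g ∘ (0 : hom X Y) = 0.
Proof. by apply: (addrI (g ∘ 0)); rewrite -compDr !addr0. Qed.

Lemma is_zero_id (X : C) : idm X = 0 -> is_zero X.
Proof.
move=> X0; split=> Y f; first by rewrite -[f]compm1 X0 compm0.
by rewrite -[f]comp1m X0 comp0m.
Qed.

Lemma iso_from_zero (X Y : C) (f : hom X Y) : is_zero X -> is_iso f -> is_zero Y.
Proof. by move=> [X0 _] [g [_ fg]]; apply: is_zero_id; rewrite -fg [f]X0 comp0m. Qed.

Lemma iso_to_zero (X Y : C) (f : hom X Y) : is_zero Y -> is_iso f -> is_zero X.
Proof. by move=> [Y0 _] [g [gf _]]; apply: is_zero_id; rewrite -gf [g]Y0 comp0m. Qed.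

End ZeroMorphisms.

Lemma functor_zero (A B : preadditive) (F : additiveFunctor A B) (X : A) :
  is_zero X -> is_zero (F X).
Proof. by case=> X0 _; apply: is_zero_id; rewrite -fmap1 [idm X]X0 raddf0. Qed.

(** Both lemmas say that the adjunction bijection on Hom groups preserves and
    reflects their vanishing. *)
Section AdjunctionZero.
Variables (A B : preadditive) (F : additiveFunctor A B) (G : additiveFunctor B A).
Hypothesis FG : adjunction F G.

Lemma left_hom_zero (X : A) (Y : B) :
  (forall f : hom X (G Y), f = 0) -> forall g : hom (F X) Y, g = 0.
Proof.
move=> XGY g; have := counit_nat FG g.
move=> /(congr1 (fun h => h ∘ fmap F (adj_unit FG X))).
rewrite -!compA -fmap_comp counit_unit compm1 => <-.
by rewrite [_ ∘ adj_unit FG X]XGY raddf0 compm0.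
Qed.

Lemma right_hom_zero (X : A) (Y : B) :
  (forall g : hom (F X) Y, g = 0) -> forall f : hom X (G Y), f = 0.
Proof.
move=> FXY f; have := unit_nat FG f.
move=> /(congr1 (fun h => fmap G (adj_counit FG Y) ∘ h)).
rewrite !compA -fmap_comp unit_counit comp1m => ->.
by rewrite [adj_counit FG Y ∘ _]FXY raddf0 comp0m.
Qed.

End AdjunctionZero.

(** * Conflations *)

Section Conflations.
Variable C : extriangulated.

(** The identity of A is an inflation with cone 0, and (ET3) compares it with x. *)
Lemma conflation_comp0 (A B D : C) (x : hom A B) (y : hom B D) :
  conflation x y -> y ∘ x = 0.
Proof.
move=> [d dxy]; have split0 := real_split A (zero_obj C).
have comm : (x ∘ prl_m A (zero_obj C)) ∘ inl_m A (zero_obj C) = x ∘ idm A.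
  by rewrite -compA prl_inl.
have [c [cy _]] := ET3 split0 dxy comm.
move/(congr1 (fun h => h ∘ inl_m A (zero_obj C))): cy.
by rewrite -!compA prl_inl prr_inl compm1 compm0 => <-.
Qed.

(** One half of the exactness of Hom(B,Z) -> Hom(A,Z) -> E(D,Z): since the class
    0 is split, killing the extension along u extends u to the middle term. *)
Lemma push_eq0_factor (A B D Z : C) (d : Ext C D A) (x : hom A B) (y : hom B D)
    (u : hom A Z) :
  realizes d x y -> push u d = 0 -> exists v : hom B Z, u = v ∘ x.
Proof.
move=> dxy ud.
have pushE : push u d = pull (idm D) (0 : Ext C D Z) by rewrite ud raddf0.
have [b [bx _]] := real_mor dxy (real_split Z D) pushE.
by exists (prl_m Z D ∘ b); rewrite -compA bx compA prl_inl comp1m.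
Qed.

Lemma pull_eq0_factor (A B D Z : C) (d : Ext C D A) (x : hom A B) (y : hom B D)
    (u : hom Z D) :
  realizes d x y -> pull u d = 0 -> exists v : hom Z B, u = y ∘ v.
Proof.
move=> dxy ud.
have pushE : push (idm A) (0 : Ext C Z A) = pull u d by rewrite ud raddf0.
have [b [_ yb]] := real_mor (real_split A Z) dxy pushE.
by exists (b ∘ inr_m A Z); rewrite compA yb -compA prr_inr compm1.
Qed.

Lemma inflation_from_zero (Z W : C) (f : hom Z W) : is_zero Z -> inflation f.
Proof.
move=> [Z0l Z0r]; exists W, (idm W), 0.
apply/(real_class _ _ (real_split Z W)); exists (prr_m Z W); split.
- exists (inr_m Z W); split; last exact: prr_inr.
  by rewrite -biprod_id [prl_m Z W]Z0r compm0 add0r.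
- by rewrite [RHS]Z0l prr_inl.
- exact: comp1m.
Qed.

Lemma deflation_to_zero (W Z : C) (f : hom W Z) : is_zero Z -> deflation f.
Proof.
move=> [Z0l Z0r]; exists W, (idm W), 0.
apply/(real_class _ _ (real_split W Z)); exists (prl_m W Z); split.
- exists (inl_m W Z); split; last exact: prl_inl.
  by rewrite -biprod_id [prr_m W Z]Z0r compm0 addr0.
- exact: prl_inl.
- by rewrite [LHS]Z0r [RHS]Z0r.
Qed.

End Conflations.

(** * Functors that annihilate cones and cocones *)

(** Two cocones K0, K of n are compared by morphisms a : K -> K0, a' : K0 -> K
    over the middle term.  The endomorphism 1 - a'a of K kills the extension,
    so it factors through K -> X.  A functor killing K0 and K -> X therefore
    kills the identity of K; it kills K -> X as soon as F n is a split mono. *)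
Lemma cocone_functor_zero (B : extriangulated) (A : preadditive)
    (F : additiveFunctor B A) (K0 K X D : B) (k0 : hom K0 X) (k : hom K X)
    (n : hom X D) (r : hom (F D) (F X)) :
  conflation k0 n -> conflation k n -> r ∘ fmap F n = idm (F X) ->
  is_zero (F K0) -> is_zero (F K).
Proof.
move=> [d0 r0] cK rn [FK0 _]; have nk0 := conflation_comp0 cK.
case: cK => d rd.
have Fk0 : fmap F k = 0.
  by rewrite -[LHS]comp1m -rn -compA -fmap_comp nk0 raddf0 compm0.
have comm : idm D ∘ n = n ∘ idm X by rewrite comp1m compm1.
have [a [_ ad]] := ET3op rd r0 comm.
have [a' [_ ad']] := ET3op r0 rd comm.
have ud : push (idm K - a' ∘ a) d = 0.
  apply: (addIr (push (a' ∘ a) d)).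
  by rewrite -pushDm subrK push1 push_comp ad pull1 ad' pull1 add0r.
have [v uE] := push_eq0_factor rd ud.
have Fu : fmap F (idm K - a' ∘ a) = 0 by rewrite uE fmap_comp Fk0 compm0.
apply: is_zero_id; rewrite -fmap1 -[idm K](subrK (a' ∘ a)).
by rewrite raddfD Fu add0r fmap_comp [fmap F a']FK0 comp0m.
Qed.

Lemma cone_functor_zero (B : extriangulated) (A : preadditive)
    (F : additiveFunctor B A) (D X K0 K : B) (t : hom D X) (k0 : hom X K0)
    (k : hom X K) (s : hom (F X) (F D)) :
  conflation t k0 -> conflation t k -> fmap F t ∘ s = idm (F X) ->
  is_zero (F K0) -> is_zero (F K).
Proof.
move=> [d0 r0] cK ts [FK0 _]; have kt0 := conflation_comp0 cK.
case: cK => d rd.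
have Fk0 : fmap F k = 0.
  by rewrite -[LHS]compm1 -ts compA -fmap_comp kt0 raddf0 comp0m.
have comm : idm X ∘ t = t ∘ idm D by rewrite comp1m compm1.
have [a [_ ad]] := ET3 rd r0 comm.
have [a' [_ ad']] := ET3 r0 rd comm.
have ud : pull (idm K - a' ∘ a) d = 0.
  apply: (addIr (pull (a' ∘ a) d)).
  by rewrite -pullDm subrK pull1 pull_comp -ad' push1 -ad push1 add0r.
have [v uE] := pull_eq0_factor rd ud.
have Fu : fmap F (idm K - a' ∘ a) = 0 by rewrite uE fmap_comp Fk0 comp0m.
apply: is_zero_id; rewrite -fmap1 -[idm K](subrK (a' ∘ a)).
by rewrite raddfD Fu add0r fmap_comp [fmap F a']FK0 comp0m.
Qed.

Section WWZFunctors.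
Variables (A B : extriangulated) (F : additiveFunctor A B).

Lemma WWZ_right_exact_deflation (Y Z : A) (g : hom Y Z) :
  WWZ_right_exact_functor F -> deflation g -> deflation (fmap F g).
Proof.
move=> [_ _ [A' [y [eta [_ real _]]]]] [X [f [d dfg]]].
by have [x [_ rx]] := real _ _ _ _ _ _ dfg; exists (A' Z X d), x, (eta Z X d).
Qed.

Lemma WWZ_left_exact_inflation (X Y : A) (f : hom X Y) :
  WWZ_left_exact_functor F -> inflation f -> inflation (fmap F f).
Proof.
move=> [_ _ [C' [y [eta [_ real _]]]]] [Z [g [d dfg]]].
by have [x [_ rx]] := real _ _ _ _ _ _ dfg; exists (C' Z X d), x, (eta Z X d).
Qed.

(** Compatibility is used exactly here: in a triangulated category every
    morphism 0 -> K is both an inflation and a deflation. *)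
Lemma compatible_from_zero (Y K : A) (g : hom Y K) :
  WWZ_right_exact_functor F -> deflation g -> compatible g ->
  is_zero (F Y) -> is_zero (F K).
Proof.
move=> exF dg cg FY; case: (exF) => presF _ _.
apply: (iso_from_zero FY); apply: (presF _ _ _ cg).
by split; [exact: inflation_from_zero | exact: WWZ_right_exact_deflation].
Qed.

Lemma compatible_to_zero (K Y : A) (g : hom K Y) :
  WWZ_left_exact_functor F -> inflation g -> compatible g ->
  is_zero (F Y) -> is_zero (F K).
Proof.
move=> exF ig cg FY; case: (exF) => presF _ _.
apply: (iso_to_zero FY); apply: (presF _ _ _ cg).
by split; [exact: WWZ_left_exact_inflation | exact: deflation_to_zero].
Qed.

End WWZFunctors.

(** * The recollement *)

Section Recollement.
Variables (A B C : extriangulated) (R : recollementDiagram A B C).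

Lemma i_upper_j_shriek_zero (Z : C) :
  (forall Y : A, is_zero (j_upper R (i_lower R Y))) ->
  is_zero (i_upper R (j_shriek R Z)).
Proof.
move=> ji0; apply: is_zero_id; apply: (left_hom_zero (adj_iu_il R)).
apply: (left_hom_zero (adj_js_ju R)) => f; exact: (ji0 _).2.
Qed.

Lemma i_shriek_j_lower_zero (Z : C) :
  (forall Y : A, is_zero (j_upper R (i_lower R Y))) ->
  is_zero (i_shriek R (j_lower R Z)).
Proof.
move=> ji0; apply: is_zero_id; apply: (right_hom_zero (adj_il_is R)).
apply: (right_hom_zero (adj_ju_jl R)) => f; exact: (ji0 _).1.
Qed.

Lemma essential_image_ker_i_shriek (Y : A) (X : B) :
  isomorphic (i_lower R Y) X -> is_zero (i_shriek R X) -> is_zero X.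
Proof.
move=> [f [g [_ fg]]] [_ isX0]; apply: is_zero_id.
by rewrite -fg (left_hom_zero (adj_il_is R) (isX0 Y) f) comp0m.
Qed.

End Recollement.

Theorem proposition4p9 (A B C : extriangulated)
  (wicA : WIC A) (wicB : WIC B) (wicC : WIC C)
  (R : recollementDiagram A B C) :
  WWZ_recollement R -> s_recollement R.
Proof.
move=> [[[exi _] [exj _]] [[exiU _] [exiS _]] imker ff seqs].
have ji0 Y : is_zero (j_upper R (i_lower R Y)).
  by apply/imker; exists Y, (idm _), (idm _); rewrite comp1m.
split=> // [X|].
- have [[Y [h [K [g1 [g2 [cK1 cK2 thE cg2]]]]]]
    [Y' [h' [K' [g1' [g2' [cK1' cK2' upE cg1']]]]]]] := seqs X.
  have ig2 : inflation g2 by exists (i_lower R Y), h.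
  have dg1' : deflation g1' by exists (i_lower R Y'), h'.
  split.
  + by exists K, g1, g2.
  + by exists K', g2', g1'.
  + move=> K1 [k ck].
    apply: (cone_functor_zero cK1 ck (unit_counit (adj_il_is R) X)).
    exact: (compatible_to_zero exiS ig2 cg2 (i_shriek_j_lower_zero _ ji0)).
  + move=> K1 [k ck].
    apply: (cocone_functor_zero cK2' ck (counit_unit (adj_iu_il R) X)).
    exact: (compatible_from_zero exiU dg1' cg1' (i_upper_j_shriek_zero _ ji0)).
- left=> X isX0 jX0; have [Y Yiso] := (imker X).2 jX0.
  exact: essential_image_ker_i_shriek Yiso isX0.
Qed.
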